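(* Let $L$ be a positive integer, $C$ a positive real number, $m\ge 1$ and $d>1$ integers. Let $f(x)=x^d+a_{d-1}x^{d-1}+\dots+a_0\in\mathbb{Z}[x]$. Let $D_t$ be a product distribution on $T_0\times\dots\times T_m\subset\mathbb{Z}^{m+1}$, where each $T_i$ is a finite set with $|T_i|=k_i>0$, such that the distribution on each $T_i$ is $(C,2^dL)$-uniform. Suppose that the following two conditions hold: (1) There is a deterministic polynomial function $F:\mathbb{R}^{m+1}\to\mathbb{R}^{d-1}$ of degree at most $L$ such that the distribution $D_a$ of $(a_0,a_1,\dots,a_{d-1})$ is the push-forward of $D_t$ under the map $(t_0,t_1,\dots,t_m)\mapsto(a_0,a_1,\dots,a_{d-1}):=(t_0,F(t_0,\dots,t_m))$. (2) For all positive integers $k<d$, all integers $a_0\ne0$ and all integers $b_0$ with $b_0\mid a_0$, the polynomial $$P_{d,k,a_0,b_0}(F(a_0,t_1,\dots,t_m))$$ in the variables $t_1,\dots,t_m$ is not identically zero. Then the probability that $f(x)$ is irreducible over $\mathbb{Z}$ is at least $$1-\mathbb{P}_{D_0}(a_0=0)-2Cd2^dL\,\tau(D_0)\sum_{i=1}^{m}\frac{1}{k_i},$$ where $D_0$ is the distribution of $a_0$ and $\tau(D_0):=\mathbb{E}_{D_0}[\tau(a_0)I(a_0\ne0)]$.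
   Context: For a nonzero integer $n$, $\tau(n)$ denotes the number of positive divisors of $n$, and $I(\cdot)$ denotes the indicator function. A distribution $D$ supported on a finite subset of $\mathbb{C}$ of size $k$ is called $(C,t)$-uniform if for any subset $T$ of $\mathbb{C}$ of size at most $t$, $D(T)\le\frac{C|T|}{k}$. (For the distribution on $T_i$, the size is $k=k_i$.) For positive integers $d,k$ and integers $a_0,b_0$, define $$P_{d,k,a_0,b_0}(a_1,\dots,a_{d-1}):=\prod_{1\le i_1<i_2<\dots<i_k\le d}(b_0-\alpha_{i_1}\alpha_{i_2}\cdots\alpha_{i_k}),$$ where $\alpha_1,\dots,\alpha_d$ are the complex roots (with multiplicity) of $x^d+a_{d-1}x^{d-1}+\dots+a_1x+a_0\in\mathbb{C}[x]$. Being symmetric in the roots, it is a polynomial in $a_1,\dots,a_{d-1}$ depending only on $d,k,a_0,b_0$. A monic integer polynomial of positive degree is irreducible over $\mathbb{Z}$ if it is not a product of two polynomials in $\mathbb{Z}[x]$ of positive degree. *)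

(* Defs.v *)
From HB Require Import structures.
From mathcomp Require Import all_boot all_order all_algebra finmap.
From mathcomp Require Import boolp reals complex mpoly.
Set Implicit Arguments.
Unset Strict Implicit.
Unset Printing Implicit Defensive.
Import Order.TTheory GRing.Theory Num.Theory.
Local Open Scope fset_scope.
Local Open Scope ring_scope.

Definition is_distr (R : realType) (Om : finType) (p : Om -> R) : Prop :=
  (forall w, 0 <= p w) /\ \sum_w p w = 1.

Definition prob (R : realType) (Om : finType) (p : Om -> R) (E : Om -> Prop) : R :=
  \sum_(w | `[< E w >]) p w.

Definition expect (R : realType) (Om : finType) (p X : Om -> R) : R :=
  \sum_w p w * X w.

Definition pushforward (R : realType) (Om : finType) (W : eqType)
    (p : Om -> R) (X : Om -> W) (w : W) : R :=
  \sum_(o | X o == w) p o.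

Definition prod_distr (R : realType) (I : finType) (Om : I -> finType)
    (p : forall i, Om i -> R) (w : {dffun forall i, Om i}) : R :=
  \prod_i p i (w i).

(* The test sets A range over subsets of the complex numbers, into which the
   integer support S embeds. *)
Definition CT_uniform (R : realType) (C : R) (t : nat) (S : {fset int})
    (p : S -> R) : Prop :=
  forall A : {fset R[i]}, (#|` A| <= t)%N ->
    \sum_(x : S | ((val x)%:~R : R[i]) \in A) p x
      <= C * (#|` A|)%:R / (#|` S|)%:R.

(* The entry a 0 j is the coefficient a_{j+1} of 'X^(j+1). *)
Definition monic_of (K : nzRingType) (d : nat) (a0 : K) (a : 'rV[K]_d.-1) :
    {poly K} :=
  'X^d + \sum_(j < d.-1) a 0 j *: 'X^(j.+1) + a0%:P.

Definition irreducibleZ (f : {poly int}) : Prop :=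
  (1 < size f)%N /\
  ~ exists g h : {poly int}, [/\ (1 < size g)%N, (1 < size h)%N & f = g * h].

(* The roots with multiplicity, in an unspecified order. *)
Definition croots (R : realType) (p : {poly R[i]}) : seq R[i] :=
  sval (closed_field_poly_normal p).

(* The value of the symmetric product at a point a = (a_1, ..., a_(d-1)); it is
   independent of the order in which croots lists the roots. *)
Definition Pdk (R : realType) (d k : nat) (a0 b0 : int) (a : 'rV[R[i]]_d.-1) : R[i] :=
  let alpha := croots (monic_of a0%:~R a) in
  \prod_(I : {set 'I_d} | #|I| == k) (b0%:~R - \prod_(i in I) alpha`_i).

Definition tau (n : int) : nat := size (divisors `|n|%N).

Definition cons_pt (R : realType) (m : nat) (t0 : R) (t : 'I_m -> R) :
    'I_m.+1 -> R :=
  fun i => if unlift ord0 i is Some j then t j else t0.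

Definition evalF (R : realType) (n e : nat) (F : 'I_e -> {mpoly R[n]})
    (t : 'I_n -> R) : 'rV[R]_e :=
  \row_j (F j).@[t].

Definition tau_distr (R : realType) (Om : finType) (p : Om -> R) (X : Om -> int) :
    R :=
  expect p (fun w => (tau (X w))%:R * (X w != 0)%:R).

(* Both sides of the push-forward condition live in R^d, written as pairs
   (a_0, (a_1, ..., a_(d-1))): the coefficients are integers, whereas F is only
   assumed to have real values. *)
Definition real_coefs (R : realType) (e : nat) (a : int * 'rV[int]_e) :
    R * 'rV[R]_e :=
  (a.1%:~R, map_mx intr a.2).

Definition param_coefs (R : realType) (m e : nat) (F : 'I_e -> {mpoly R[m.+1]})
    (t : 'I_m.+1 -> int) : R * 'rV[R]_e :=
  ((t ord0)%:~R, evalF F (fun i => (t i)%:~R)).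

(* Main.v *)
(* If f = g h with 0 < deg g = j < d, then b = (-1)^j lc(g) g(0) divides a_0 and
   is the product of j of the roots of f, so that P_{d,j,a_0,b}(a) = 0.  Given
   a_0 there are fewer than d values of j and 2 tau(a_0) values of b.

   As a symmetric polynomial in the roots P_{d,j,a_0,b} has degree at most 2^d in
   each root, hence total degree at most 2^d in the coefficients, so on every
   coordinate line the function phi = P_{d,j,a_0,b} o F is a polynomial of degree
   at most 2^d L.  Let phi(s) != 0.  If phi(t_1, ..., t_m) = 0, then changing the
   coordinates of s into those of t one after the other there is a first step i
   at which phi vanishes; given the other coordinates, t_i is then a root of a
   nonzero polynomial of degree at most 2^d L, which has probability at most
   C 2^d L / k_i. *)
Require Import Defs.
From HB Require Import structures.
From mathcomp Require Import all_boot all_order fingroup perm all_algebra finmap.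
From mathcomp Require Import boolp reals complex ssrcomplements mpoly zify ring.
Set Implicit Arguments.
Unset Strict Implicit.
Unset Printing Implicit Defensive.
Import Order.TTheory GRing.Theory Num.Theory.
Local Open Scope fset_scope.
Local Open Scope ring_scope.

(** * Exponents of single variables in a multivariate polynomial *)

Definition exps_le n (R : nzRingType) (N : nat) (p : {mpoly R[n]}) :=
  forall m i, m \in msupp p -> (m i <= N)%N.

Section ExponentBound.
Variables (n : nat) (R : nzRingType).
Implicit Types p q : {mpoly R[n]}.

Lemma exps_leM M N p q : exps_le M p -> exps_le N q -> exps_le (M + N) (p * q).
Proof.
move=> hp hq m i /msuppM_le /allpairsP[[m1 m2] [/= h1 h2 ->]].
by rewrite mnmDE leq_add ?hp ?hq.
Qed.

Lemma exps_le1 N : exps_le N (1 : {mpoly R[n]}).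
Proof. by move=> m i; rewrite msupp1 inE => /eqP->; rewrite mnm0E. Qed.

Lemma exps_leXn N p k : exps_le N p -> exps_le (k * N) (p ^+ k).
Proof.
move=> hp; elim: k => [|k IH]; first by rewrite expr0; apply: exps_le1.
by rewrite exprS mulSn; apply: exps_leM.
Qed.

Lemma exps_le_prod (I : Type) (r : seq I) (P : pred I) (F : I -> {mpoly R[n]})
    (N : I -> nat) :
  (forall i, P i -> exps_le (N i) (F i)) ->
  exps_le (\sum_(i <- r | P i) N i) (\prod_(i <- r | P i) F i).
Proof.
move=> hF; elim/big_rec2: _ => [|i p k Pi]; first exact: exps_le1.
by move=> hk; apply: exps_leM => //; apply: hF.
Qed.

Lemma exps_leB N p q : exps_le N p -> exps_le N q -> exps_le N (p - q).
Proof.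
move=> hp hq m i /msuppB_le; rewrite mem_cat => /orP[].
- exact: hp.
- exact: hq.
Qed.

Lemma exps_leZ N c p : exps_le N p -> exps_le N (c *: p).
Proof. by move=> hp m i /msuppZ_le; apply: hp. Qed.

Lemma exps_le_mesym k : exps_le 1 (mesym n R k).
Proof.
move=> m i; rewrite msupp_mesymP => /existsP[h /andP[_ /eqP ->]].
by rewrite mnmE leq_b1.
Qed.

End ExponentBound.

(** * Degrees in the fundamental theorem on symmetric polynomials *)

Section SymmetricDegree.
Variables (n : nat) (R : comNzRingType).
Local Notation S := [tuple mesym n R i.+1 | i < n].

(** [symf1] subtracts a multiple of a product of elementary symmetric polynomials, whose exponents
    are the successive drops of the leading exponents. These decrease weakly, so the drops sum to
    the first one, at most [N]. The elementary factors are multilinear, so this sum also bounds the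
    exponents of the subtracted product. *)
Lemma symf1_degree N (p : {mpoly R[n]}) :
  p \is symmetric -> exps_le N p ->
  (msize (symf1 p).1 <= N.+1)%N /\ exps_le N (symf1 p).2.
Proof.
move=> sym_p hp; rewrite /symf1; case: eqVneq => [_|nz_p] /=.
  by split=> [|m i]; rewrite ?msize0 // msupp0.
set c := nth 0%N (mlead p); set m := [multinom _ | _ < n].
have hm : (\sum_(i < n) m i <= N)%N.
  rewrite (eq_bigr (fun i : 'I_n => c i - c i.+1)%N); last first.
    by move=> i _; rewrite mnmE.
  have hc0 : (c 0%N <= N)%N.
    have [n0|n0] := posnP n; first by rewrite /c nth_default // size_tuple n0.
    rewrite (_ : c 0%N = mlead p (Ordinal n0)).
      by apply/hp/mlead_supp.
    by rewrite (mnm_nth 0%N).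
  apply: leq_trans hc0.
  (* Telescoping to [c 0 - c n], where [c n] is the default 0 of [nth]; truncated subtraction
     requires the monotonicity of [c]. *)
  rewrite -(big_mkord xpredT (fun i => c i - c i.+1)%N) sumn_range ?leq_subr //.
  move=> i j; rewrite !addn0 subn0 ltnS => /andP[ij]; rewrite leq_eqVlt => /predU1P[->|jn].
    by rewrite {1}/c nth_default // size_tuple.
  have := mlead_msym_sorted sym_p (i := Ordinal (leq_ltn_trans ij jn)) (j := Ordinal jn) ij.
  by rewrite !(mnm_nth 0%N).
split.
  by apply: leq_trans (msizeZ_le _ _) _; rewrite msizeX ltnS mdegE.
apply: exps_leB => //; apply: exps_leZ; rewrite comp_mpolyX.
move=> m' i hm'; apply: leq_trans hm.
move: m' i hm'; apply: exps_le_prod => i _.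
rewrite -[X in exps_le X](muln1 (m i)); apply: exps_leXn.
by rewrite tnth_map; apply: exps_le_mesym.
Qed.

(* Reducing the leading monomial m of p uses a monomial in the elementary
   symmetric polynomials of total degree m 0, so that the total degree needed
   is the largest exponent of a single variable in p. *)
Lemma sym_fundamental_exps N (p : {mpoly R[n]}) :
  p \is symmetric -> exps_le N p ->
  exists2 t : {mpoly R[n]}, t \mPo S = p & (msize t <= N.+1)%N.
Proof.
elim/mleadrect: p => p IH sym_p hp.
have [ht hq] := symf1_degree sym_p hp.
have /and3P[hlt sym_q /eqP pE] := symf1P sym_p.
have [t tE tN] : exists2 t : {mpoly R[n]}, t \mPo S = (symf1 p).2 & (msize t <= N.+1)%N.
  case/orP: hlt => [/eqP ->|hlt]; last exact: IH.
  by exists 0; rewrite ?raddf0 // msize0.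
exists ((symf1 p).1 + t); first by rewrite raddfD /= tE -pE.
by apply: leq_trans (mmeasureD_le _ _ _) _; rewrite geq_max ht.
Qed.

End SymmetricDegree.

(** * The product over index sets, with indeterminate roots *)

Section SubsetProducts.
Variables (d : nat) (K : comNzRingType).

Definition subset_prods (k : nat) (b : K) : {mpoly K[d]} :=
  \prod_(I : {set 'I_d} | #|I| == k) (b%:MP - \prod_(i in I) 'X_i).

Lemma subset_prods_sym k b : subset_prods k b \is symmetric.
Proof.
apply/issymP => s; rewrite /subset_prods rmorph_prod /=.
(* A permutation of the variables permutes the index sets of size [k]. *)
rewrite [RHS](reindex (fun I : {set 'I_d} => s @: I)); last first.
  exists (fun I : {set 'I_d} => (s^-1)%g @: I) => I _; rewrite -imset_comp.
  - by rewrite (eq_imset _ (permK s)) imset_id.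
  - by rewrite (eq_imset _ (permKV s)) imset_id.
apply: eq_big => [I|I _]; first by rewrite (card_imset _ (@perm_inj _ s)).
rewrite rmorphB /= rmorph_prod /= /msym mmapC; congr (_ - _).
rewrite big_imset /=; last by move=> x y _ _; apply: perm_inj.
by apply: eq_bigr => i _; rewrite mmapX mmap1U.
Qed.

(** Each factor has exponent at most 1 in every variable, and there are at most [2 ^ d] index
    sets. *)
Lemma exps_le_subset_prods k b : exps_le (2 ^ d) (subset_prods k b).
Proof.
move=> m i hm; apply: leq_trans (_ : \sum_(I : {set 'I_d} | #|I| == k) 1 <= _)%N.
  move: m i hm; apply: exps_le_prod => I _; apply: exps_leB.
    by move=> m i; rewrite msuppC; case: ifP => // _; rewrite inE => /eqP ->; rewrite mnm0E.
  rewrite mprodXE => m i; rewrite msuppX inE => /eqP ->.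
  rewrite mnm_sumE; apply: leq_trans (_ : \sum_(j : 'I_d | j == i) 1 <= 1)%N.
    rewrite [X in (_ <= X)%N]big_mkcond [X in (X <= _)%N]big_mkcond leq_sum // => j _.
    by rewrite mnm1E; case: ifP => // _; case: (j == i).
  by rewrite big_pred1_eq.
rewrite sum1_card -[X in (2 ^ X)%N](card_ord d) -cardsT -card_powerset.
by apply: subset_leq_card; apply/subsetP => I _; rewrite inE subsetT.
Qed.

End SubsetProducts.

(** * Degrees under substitution of univariate polynomials *)

Lemma size_mmap_polyC n (R K : comNzRingType) (f : R -> K) (c : 'I_n -> {poly K})
    (M N : nat) (p : {mpoly R[n]}) :
  (msize p <= M.+1)%N -> (forall i, (size (c i) <= N.+1)%N) ->
  (size (mmap (fun a => (f a)%:P) c p) <= (M * N).+1)%N.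
Proof.
move=> hp hc; rewrite /mmap big_seq; apply: (leq_trans (size_sum _ _ _)).
apply/bigmax_leqP_seq => m _ hm.
rewrite mul_polyC; apply: (leq_trans (size_scale_leq _ _)).
have hmM : (mdeg m <= M)%N by rewrite -ltnS (leq_trans (msize_mdeg_lt hm)).
suff h : (size (mmap1 c m) <= (mdeg m * N).+1)%N.
  by apply: leq_trans h _; rewrite ltnS leq_mul2r hmM orbT.
rewrite /mmap1 mdegE big_distrl /=.
elim/big_rec2: _ => [|i s p' _ IH]; first by rewrite size_poly1.
apply: leq_trans (size_polyMleq _ _) _.
have h1 : (size (c i ^+ m i) <= (m i * N).+1)%N.
  elim: (m i) => [|e IHe]; first by rewrite expr0 size_poly1.
  rewrite exprS; apply: leq_trans (size_polyMleq _ _) _.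
  rewrite -subn1 leq_subLR add1n mulSn.
  by apply: leq_trans (leq_add (hc i) IHe) _; rewrite addSn addnS.
rewrite -subn1 leq_subLR add1n.
by apply: leq_trans (leq_add h1 IH) _; rewrite addSn addnS.
Qed.

Lemma horner_mmap_polyC n (R K : comNzRingType) (f : R -> K) (c : 'I_n -> {poly K})
    (p : {mpoly R[n]}) x :
  (mmap (fun a => (f a)%:P) c p).[x] = mmap f (fun i => (c i).[x]) p.
Proof.
rewrite /mmap horner_sum; apply: eq_bigr => m _; rewrite hornerM hornerC.
by rewrite /mmap1 horner_prod; congr (_ * _); apply: eq_bigr => i _; rewrite horner_exp.
Qed.

(** * Coefficients of the monic polynomial *)

Section MonicOf.
Variables (K : nzRingType) (d : nat) (a0 : K) (a : 'rV[K]_d.-1).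
Hypothesis d_gt0 : (0 < d)%N.

Lemma coef_monic_of i :
  (monic_of a0 a)`_i
  = (i == d)%:R + \sum_(j < d.-1) a 0 j * (i == j.+1)%:R + a0 * (i == 0%N)%:R.
Proof.
rewrite /monic_of !coefD coefXn coef_sum coefC; congr (_ + _ + _).
  by apply: eq_bigr => j _; rewrite coefZ coefXn.
by case: eqP; rewrite ?mulr1 ?mulr0.
Qed.

Lemma coef0_monic_of : (monic_of a0 a)`_0 = a0.
Proof.
rewrite coef_monic_of eqxx mulr1 big1 ?addr0 => [|j _]; last by rewrite mulr0.
by rewrite ltn_eqF // add0r.
Qed.

Lemma coefS_monic_of (j : 'I_d.-1) : (monic_of a0 a)`_j.+1 = a 0 j.
Proof.
rewrite coef_monic_of mulr0 addr0 (bigD1 j) //= eqxx mulr1 big1.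
  by rewrite addr0 ltn_eqF ?add0r // -ltn_predRL.
by move=> i ij; rewrite eqSS eq_sym (inj_eq val_inj) (negbTE ij) mulr0.
Qed.

Lemma coefd_monic_of : (monic_of a0 a)`_d = 1.
Proof.
rewrite coef_monic_of eqxx big1 => [|j _].
  by rewrite gtn_eqF // mulr0 !addr0.
by rewrite gtn_eqF ?mulr0 // -ltn_predRL.
Qed.

Lemma size_monic_of : size (monic_of a0 a) = d.+1.
Proof.
apply/eqP; rewrite eqn_leq; apply/andP; split; last first.
  by apply: contraNT (oner_neq0 K); rewrite -leqNgt -coefd_monic_of => h; rewrite nth_default.
apply/leq_sizeP => j hj; rewrite coef_monic_of gtn_eqF // big1 => [|i _].
  by rewrite gtn_eqF ?mulr0 ?addr0 // (leq_trans _ hj).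
by rewrite gtn_eqF ?mulr0 // (leq_trans _ hj) // ltnS ltnW // -ltn_predRL.
Qed.

Lemma monic_ofP : monic_of a0 a \is monic.
Proof. by rewrite monicE lead_coefE size_monic_of coefd_monic_of. Qed.

End MonicOf.

Lemma map_monic_of (K K' : nzRingType) (f : {rmorphism K -> K'}) d a0
    (a : 'rV[K]_d.-1) :
  map_poly f (monic_of a0 a) = monic_of (f a0) (map_mx f a).
Proof.
rewrite /monic_of !rmorphD /= map_polyXn map_polyC rmorph_sum /=.
congr (_ + _ + _); apply: eq_bigr => j _.
by rewrite map_polyZ /= map_polyXn mxE.
Qed.

Lemma ord_pred_cases d (i : 'I_d) :
  i = 0%N :> nat \/ exists j : 'I_d.-1, i = j.+1 :> nat.
Proof.
case: i => [[|i] hi] /=; first by left.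
by right; have hi' : (i < d.-1)%N by [case: d hi]; exists (Ordinal hi').
Qed.

(** * The symmetric product as a polynomial in the coefficients *)

Section RootProducts.
Variables (R : realType) (d : nat).
Hypothesis d_gt0 : (0 < d)%N.
Local Notation C := R[i].

Lemma croots_monic (p : {poly C}) :
  p \is monic -> p = \prod_(z <- croots p) ('X - z%:P).
Proof.
rewrite /croots; case: closed_field_poly_normal => r /= h /monicP lp.
by rewrite {1}h lp scale1r.
Qed.

Lemma size_croots (p : {poly C}) : p \is monic -> size (croots p) = (size p).-1.
Proof. by move=> /croots_monic {2}->;  rewrite size_prod_XsubC. Qed.

(** By Vieta, the elementary symmetric functions of the roots are signed coefficients; one [t]
    serves all [a0] and [a]. *)
Lemma Pdk_elementary k b0 :
  exists2 t : {mpoly C[d]}, (msize t <= (2 ^ d).+1)%N &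
    forall a0 (a : 'rV[C]_d.-1), Pdk k a0 b0 a =
      t.@[fun i : 'I_d => (-1) ^+ i.+1 * (monic_of a0%:~R a)`_(d - i.+1)].
Proof.
have [t tE ht] := sym_fundamental_exps (subset_prods_sym d k (b0%:~R : C))
  (exps_le_subset_prods (d := d) (k := k) (b := b0%:~R : C)).
exists t => // a0 a; rewrite /Pdk.
set f := monic_of _ a; have fm : f \is monic by exact: monic_ofP.
have szr : size (croots f) == d by rewrite size_croots // size_monic_of.
pose r := Tuple szr.
transitivity ((subset_prods d k (b0%:~R : C)).@[tnth r]).
  rewrite /subset_prods rmorph_prod /=; apply: eq_bigr => I _.
  rewrite mevalB mevalC rmorph_prod /=; congr (_ - _).
  by apply: eq_bigr => i _; rewrite mevalXU (tnth_nth 0).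
rewrite -tE comp_mpoly_meval; apply: meval_eq => i; rewrite tnth_map tnth_ord_tuple.
have := mroots_coeff r (Ordinal (ltn_ord i : (i.+1 < d.+1)%N)) => /=.
by rewrite -croots_monic // => ->; rewrite mulrA -signr_odd -signr_addb addbb mul1r.
Qed.

Lemma Pdk_line k a0 b0 (N : nat) (c : 'I_d.-1 -> {poly C}) :
  (forall j, (size (c j) <= N.+1)%N) ->
  exists2 q : {poly C}, (size q <= (2 ^ d * N).+1)%N &
    forall x, Pdk k a0 b0 (\row_j (c j).[x]) = q.[x].
Proof.
move=> hc; have [t ht tE] := Pdk_elementary k b0.
pose e (i : 'I_d) : {poly C} :=
  (-1) ^+ i.+1 *: (monic_of a0%:~R (\row_j c j))`_(d - i.+1).
exists (mmap (fun a => a%:P) e t) => [|x].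
  apply: (size_mmap_polyC id) => // i.
  apply: (leq_trans (size_scale_leq _ _)).
  (* The index [d - i.+1] stays below [d], so the coefficient is the constant [a0] or some [c j]. *)
  have [h|[j h]] := ord_pred_cases (rev_ord i); rewrite [(d - _)%N]h.
    by rewrite coef0_monic_of // -(rmorph_int polyC) (leq_trans (size_polyC_leq1 _)).
  by rewrite coefS_monic_of // mxE.
rewrite (horner_mmap_polyC id) tE; apply: meval_eq => i.
rewrite /e hornerZ; congr (_ * _).
have [h|[j h]] := ord_pred_cases (rev_ord i); rewrite [(d - _)%N]h.
  by rewrite !coef0_monic_of // -(rmorph_int polyC) hornerC.
by rewrite !coefS_monic_of // !mxE.
Qed.

End RootProducts.

(** * From a factorization to a vanishing product *)

Lemma prod_XsubC_horner0 (K : comNzRingType) (I : finType) (A : {set I}) (z : I -> K) :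
  (\prod_(i in A) ('X - (z i)%:P)).[0] = (-1) ^+ #|A| * \prod_(i in A) z i.
Proof.
rewrite horner_prod (eq_bigr (fun i => - z i)) => [|i _]; last by rewrite hornerXsubC sub0r.
by rewrite prodrN.
Qed.

Lemma int_mul1_sqr (u v : int) : u * v = 1 -> u * u = 1.
Proof.
move/(congr1 absz); rewrite abszM => /eqP; rewrite muln_eq1 => /andP[/eqP u1 _].
by rewrite -expr2 -(real_normK (num_real u)) -abszE u1 expr1n.
Qed.

Lemma reducible_Pdk_eq0 (R : realType) (d : nat) (a0 : int) (a : 'rV[int]_d.-1) :
  (1 < d)%N -> ~ irreducibleZ (monic_of a0 a) ->
  exists j : nat, exists b0 : int, [/\ (0 < j < d)%N, (b0 %| a0)%Z &
    Pdk j a0 b0 (map_mx intr a : 'rV[R[i]]_d.-1) = 0].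
Proof.
move=> d1 nirr; have d0 : (0 < d)%N by exact: ltnW.
have szf := size_monic_of a0 a d0.
have [g [h [g1 h1 fE]]] : exists g h : {poly int},
    [/\ (1 < size g)%N, (1 < size h)%N & monic_of a0 a = g * h].
  by apply: contrapT => H; apply: nirr; split; rewrite ?szf.
have g0 : g != 0 by rewrite -size_poly_gt0 ltnW.
have h0 : h != 0 by rewrite -size_poly_gt0 ltnW.
have szgh : (size g + size h = d.+2)%N.
  have := szf; rewrite fE size_mul // => sz.
  by rewrite -(prednK (_ : 0 < size g + size h)%N) ?sz // addn_gt0 size_poly_gt0 g0.
set u := lead_coef g.
(* The leading coefficients of [g] and [h] multiply to 1, so [u] is a sign. *)
have uu : u * u = 1.
  apply: (@int_mul1_sqr _ (lead_coef h)); rewrite -lead_coefM -fE.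
  exact/monicP/monic_ofP.
pose toC : int -> R[i] := intr.
set j := (size g).-1.
have jE : size g = j.+1 by rewrite /j prednK // size_poly_gt0.
exists j, ((-1) ^+ j * u * g`_0); split.
- by rewrite jE in g1 szgh; lia.
- have -> : a0 = ((-1) ^+ j * u * h`_0) * ((-1) ^+ j * u * g`_0).
    rewrite -[a0 in LHS](coef0_monic_of a0 a d0) fE coef0M.
    rewrite mulrACA [X in _ = X * _]mulrACA -signr_odd -signr_addb addbb uu !mul1r.
    by rewrite mulrC.
  exact: dvdz_mull.
- set fC : {poly R[i]} := monic_of a0%:~R (map_mx intr a).
  have fCm : fC \is monic by exact: monic_ofP.
  have fCE : fC = map_poly intr g * map_poly intr h.
    by rewrite -rmorphM -fE /= map_monic_of.
  have szr : size (croots fC) = d by rewrite size_croots // size_monic_of.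
  have fCr : fC = \prod_(i <- index_enum 'I_d) ('X - ((croots fC)`_i)%:P).
    by rewrite {1}(croots_monic fCm) (big_nth 0) szr big_mkord.
  (* A divisor of a product of linear factors is associated to a subproduct; [A] collects the
     indices of the roots of [g]. *)
  have : map_poly intr g %| \prod_(i <- index_enum 'I_d) ('X - ((croots fC)`_i)%:P).
    by rewrite -fCr fCE dvdp_mulr.
  case/dvdp_prod_XsubC => m gm.
  pose A := [set i in mask m (index_enum 'I_d)].
  have um : uniq (mask m (index_enum 'I_d)) by rewrite mask_uniq // index_enum_uniq.
  have mA : \prod_(i <- mask m (index_enum 'I_d)) ('X - ((croots fC)`_i)%:P)
     = \prod_(i in A) ('X - ((croots fC)`_i)%:P).
    by rewrite big_uniq //=; apply: eq_bigl => i; rewrite inE.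
  rewrite mA in gm.
  have szg : size (map_poly (intr : int -> R[i]) g) = j.+1.
    by rewrite size_map_inj_poly //; apply: intr_inj.
  have cA : #|A| = j.
    have := eqp_size gm; rewrite szg -big_enum /= size_prod_XsubC -cardE.
    by case.
  have gE : map_poly intr g = toC u *: \prod_(i in A) ('X - ((croots fC)`_i)%:P).
    have /eqpf_eq[c c0 cE] := gm.
    have := congr1 lead_coef cE; rewrite lead_coefZ.
    rewrite (monicP (monic_prod_XsubC _ _ _)) mulr1 lead_coef_map_inj //; last first.
      exact: intr_inj.
    by rewrite /toC => ->.
  have g00 : toC g`_0 = toC u * ((-1) ^+ j * \prod_(i in A) (croots fC)`_i).
    rewrite -cA -prod_XsubC_horner0 -hornerZ -gE horner_coef0 coef_map_id0 //.
  (* The factor indexed by [A] vanishes: both signs cancel, leaving the product of the roots in [A]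
     minus itself. *)
  rewrite /Pdk -/fC (bigD1 A) /= ?cA // -[X in X - _]/(toC _).
  have -> : toC ((-1) ^+ j * u * g`_0) = (-1) ^+ j * toC u * toC g`_0.
    by rewrite /toC !rmorphM /= rmorphXn rmorphN1.
  rewrite g00 mulrA -[X in X * _ - _]mulrA -rmorphM uu rmorph1 mulr1 mulrA.
  by rewrite -signr_odd -signr_addb addbb mul1r subrr mul0r.
Qed.

(** * Expectations under equal push-forwards *)

Section Pushforward.
Variables (R : realType) (W : eqType).

(** [W] may be infinite, so the sum over values runs over a duplicate-free list containing the image
    of [X]. *)
Lemma expect_pushforward (Om : finType) (p : Om -> R) (X : Om -> W) (G : W -> R)
    (s : seq W) : uniq s -> (forall o, X o \in s) ->
  \sum_o p o * G (X o) = \sum_(w <- s) pushforward p X w * G w.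
Proof.
move=> us Xs; rewrite /pushforward.
under [RHS]eq_bigr do rewrite big_distrl /= big_mkcond /=.
rewrite exchange_big /=; apply: eq_bigr => o _.
rewrite (bigD1_seq (X o)) //= eqxx big1 ?addr0 // => w wX.
by rewrite eq_sym (negbTE wX).
Qed.

Lemma eq_pushforward_expect (Om Om' : finType) (p : Om -> R) (p' : Om' -> R)
    (X : Om -> W) (X' : Om' -> W) (G : W -> R) :
  pushforward p X =1 pushforward p' X' ->
  \sum_o p o * G (X o) = \sum_o p' o * G (X' o).
Proof.
move=> e; pose s := undup (codom X ++ codom X').
have us : uniq s by exact: undup_uniq.
rewrite (expect_pushforward _ _ us) => [|o]; last by rewrite mem_undup mem_cat codom_f.
rewrite (expect_pushforward _ _ us) => [|o]; last by rewrite mem_undup mem_cat codom_f orbT.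
by apply: eq_bigr => w _; rewrite e.
Qed.

End Pushforward.

(** * Resampling one coordinate of a product distribution *)

Section Resampling.
Variables (R : realType) (I : finType) (Om : I -> finType).
Variable p : forall i, Om i -> R.
Hypothesis p_distr : forall i, is_distr (@p i).

Definition upd (t : {dffun forall i, Om i}) i (x : Om i) : {dffun forall i, Om i} :=
  [ffun j => dfwith t x j].

Lemma prod_distr_ge0 t : 0 <= prod_distr p t.
Proof. by apply: prodr_ge0 => i _; case: (p_distr i). Qed.

(** Cross-multiplied, since [p (t i)] may be 0. *)
Lemma prod_distr_upd t i (x : Om i) :
  prod_distr p (upd t x) * p (t i) = prod_distr p t * p x.
Proof.
rewrite /prod_distr (bigD1 i) //= [in RHS](bigD1 i) //= ffunE dfwith_in.
rewrite (eq_bigr (fun j => p (t j))) => [|j ji]; last first.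
  by rewrite ffunE dfwith_out // eq_sym.
by rewrite mulrAC [p x * _]mulrC mulrAC.
Qed.

(* The involution (t, x) |-> (t with x in place i, t i) preserves the weight
   prod_distr p t * p x. *)
Lemma prod_distr_resample i (G : {dffun forall i, Om i} -> R) :
  \sum_t prod_distr p t * G t
  = \sum_t prod_distr p t * (\sum_(x : Om i) p x * G (upd t x)).
Proof.
transitivity (\sum_t \sum_(x : Om i) prod_distr p t * p x * G t).
  apply: eq_bigr => t _; rewrite -big_distrl -big_distrr /=.
  by have [_ ->] := p_distr i; rewrite mulr1.
rewrite pair_bigA /=.
pose phi (tx : {dffun forall i, Om i} * Om i) := (upd tx.1 tx.2, tx.1 i).
rewrite (reindex_inj (h := phi)) /=; last first.
  apply: (can_inj (g := phi)) => -[t x]; rewrite /phi /=; congr (_, _).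
    apply/ffunP => j; rewrite ffunE.
    have [ij|ij] := eqVneq i j; first by move: ij => <-; rewrite dfwith_in.
    by rewrite dfwith_out // ffunE dfwith_out.
  by rewrite ffunE dfwith_in.
rewrite -(pair_bigA _ (fun t x => prod_distr p (upd t x) * p (t i) * G (upd t x))) /=.
apply: eq_bigr => t _; rewrite big_distrr /=; apply: eq_bigr => x _.
by rewrite prod_distr_upd mulrA.
Qed.

End Resampling.

(** * Probability of a zero, by a coordinatewise walk *)

Lemma CT_uniform_roots (R : realType) (c : R) (N : nat) (S : {fset int}) (p : S -> R)
    (q : {poly R[i]}) :
  0 < c -> (forall x, 0 <= p x) -> CT_uniform c N p -> q != 0 -> (size q <= N.+1)%N ->
  \sum_(x : S | q.[(val x)%:~R] == 0) p x <= c * N%:R / (#|` S|)%:R.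
Proof.
(* The test set consists of the distinct roots of [q]. *)
move=> c0 p0 hp q0 sq; pose A := [fset z in croots q]%fset.
have qr : q = lead_coef q *: \prod_(z <- croots q) ('X - z%:P).
  by rewrite /croots; case: closed_field_poly_normal => r /= {1}->.
have sA : (#|` A| <= N)%N.
  rewrite card_fseq; apply: leq_trans (size_undup _) _; rewrite -ltnS.
  by move: sq; rewrite {1}qr size_scale ?lead_coef_eq0 // size_prod_XsubC.
have AE z : (z \in A) = (q.[z] == 0).
  rewrite inE -[RHS]/(root q z) {2}qr rootZ ?lead_coef_eq0 //.
  by rewrite root_prod_XsubC.
under eq_bigl do rewrite -AE.
apply: le_trans (hp A sA) _.
by rewrite ler_wpM2r ?invr_ge0 // ler_wpM2l ?(ltW c0) // ler_nat.
Qed.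

Section ZeroProbability.
Variables (R : realType) (m : nat) (c : R) (N : nat).
Hypothesis c_gt0 : 0 < c.
Variables (T : 'I_m.+1 -> {fset int}) (D : forall i : 'I_m.+1, T i -> R).
Hypothesis D_distr : forall i, is_distr (@D i).
Hypothesis D_unif : forall i, CT_uniform c N (@D i).
Variable phi : ('I_m.+1 -> R) -> R[i].
Hypothesis phi_line : forall (u : 'I_m.+1 -> R) i, i != ord0 ->
  exists2 q : {poly R[i]}, (size q <= N.+1)%N &
    forall x : R, phi (fun l => if l == i then x else u l) = q.[x%:C%C].
Variable ts : 'I_m.+1 -> R.
Hypothesis phi_ts : phi ts != 0.

Definition int_pt (t : {dffun forall i, T i}) : 'I_m.+1 -> R := fun l => (val (t l))%:~R.

(** The stations of a walk from the nonzero point [ts] to the random point, one coordinate at a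
    time. *)
Definition hybrid n (t : {dffun forall i, T i}) : 'I_m.+1 -> R :=
  fun l => if (l < n)%N then int_pt t l else ts l.

Definition first_zero (i : nat) t : bool :=
  (phi (hybrid i t) != 0) && (phi (hybrid i.+1 t) == 0).

Lemma hybrid1 t : int_pt t ord0 = ts ord0 -> hybrid 1 t = ts.
Proof.
move=> h; apply/funext => l; rewrite /hybrid ltnS leqn0.
by case: eqP => // l0; rewrite (_ : l = ord0) //; apply: val_inj.
Qed.

Lemma hybrid_full t : hybrid m.+1 t = int_pt t.
Proof. by apply/funext => l; rewrite /hybrid ltn_ord. Qed.

(** A walk that starts off the zero set and ends in it must enter it at some step. Steps count from
    1 because coordinate 0 already agrees. *)
Lemma phi_hybrid_zero_le t n : int_pt t ord0 = ts ord0 ->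
  (phi (hybrid n.+1 t) == 0)%:R <= \sum_(1 <= i < n.+1) (first_zero i t)%:R :> R.
Proof.
move=> h; elim: n => [|n IH].
  by rewrite hybrid1 // (negbTE phi_ts) big_geq.
rewrite big_nat_recr //= {2}/first_zero.
have [z|nz] := eqVneq (phi (hybrid n.+1 t)) 0.
  rewrite z eqxx in IH; apply: le_trans (_ : 1 <= _); first by rewrite lern1 leq_b1.
  by rewrite addr0.
by rewrite lerDr sumr_ge0.
Qed.

Lemma int_pt_upd t i (x : T i) :
  int_pt (upd t x) = fun l => if l == i then (val x)%:~R else int_pt t l.
Proof.
apply/funext => l; rewrite /int_pt ffunE; case: eqVneq => [->|li].
  by rewrite dfwith_in.
by rewrite dfwith_out // eq_sym.
Qed.

Lemma hybrid_upd t i (x : T i) : hybrid i (upd t x) = hybrid i t.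
Proof.
apply/funext => l; rewrite /hybrid int_pt_upd; case: ifP => // li.
by case: eqP li => // ->; rewrite ltnn.
Qed.

Lemma hybridS_upd t i (x : T i) :
  hybrid i.+1 (upd t x) = fun l => if l == i then (val x)%:~R else hybrid i t l.
Proof.
apply/funext => l; rewrite /hybrid int_pt_upd ltnS leq_eqVlt (inj_eq val_inj).
by case: eqP.
Qed.

Lemma first_zero_upd_le t (i : 'I_m.+1) : i != ord0 ->
  \sum_(x : T i) D x * (first_zero i (upd t x))%:R <= c * N%:R / (#|` T i|)%:R.
Proof.
move=> i0; have [q qN qE] := phi_line (hybrid i t) i0.
have [D0 _] := D_distr i.
(* Place [i] of [hybrid i t] still holds [ts i], so the start of the step lies on the line. *)
have qts : phi (hybrid i t) = q.[(ts i)%:C%C].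
  rewrite -qE; congr phi; apply/funext => l; rewrite /hybrid.
  by case: eqP => // ->; rewrite ltnn.
(* A step starting at a zero never counts; otherwise [q] is nonzero and the step counts only at its
   roots. *)
have [q0|q0] := eqVneq (q.[(ts i)%:C%C]) 0.
  rewrite big1 => [|x _].
    by rewrite mulr_ge0 ?invr_ge0 // mulr_ge0 // ltW.
  by rewrite /first_zero hybrid_upd qts q0 eqxx mulr0.
have qn0 : q != 0 by apply: contraNneq q0 => ->; rewrite horner0.
apply: le_trans (CT_uniform_roots c_gt0 D0 (D_unif i) qn0 qN).
rewrite [leRHS]big_mkcond ler_sum // => x _.
rewrite /first_zero hybrid_upd qts q0 hybridS_upd qE rmorph_int.
by case: ifP; rewrite ?mulr1 ?mulr0.
Qed.

(** Conditioning on coordinate 0 is expressed by restricting both sums, which avoids division by a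
    possibly zero probability. *)
Lemma prob_zero_le :
  \sum_(t | int_pt t ord0 == ts ord0) prod_distr (@D) t * (phi (int_pt t) == 0)%:R
  <= c * N%:R * (\sum_(i < m.+1 | (0 < i)%N) (#|` T i|)%:R^-1)
     * \sum_(t | int_pt t ord0 == ts ord0) prod_distr (@D) t.
Proof.
pose w t : R := (int_pt t ord0 == ts ord0)%:R.
pose F t i : R := (first_zero i t)%:R.
have hF t : \sum_(1 <= i < m.+1) F t i = \sum_(i < m.+1 | (0 < i)%N) F t i.
  rewrite [RHS]big_mkcond -(big_mkord xpredT (fun i => if (0 < i)%N then F t i else 0)).
  by rewrite big_ltn //= add0r; apply: eq_big_nat => i /andP[->].
apply: le_trans (_ : \sum_t prod_distr (@D) t *
    (\sum_(i < m.+1 | (0 < i)%N) w t * F t i) <= _).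
  rewrite big_mkcond ler_sum // => t _; rewrite -big_distrr /= -hF /w.
  case: eqP => [h|_]; last by rewrite mul0r mulr0.
  rewrite mul1r ler_wpM2l ?prod_distr_ge0 // -[int_pt t]hybrid_full.
  exact: phi_hybrid_zero_le.
under eq_bigr do rewrite big_distrr /=.
rewrite exchange_big /= [c * N%:R * _]big_distrr big_distrl /= ler_sum // => i i0.
have i00 : i != ord0 by apply: contraTneq i0 => ->.
rewrite (prod_distr_resample D_distr i) big_distrr /= [leRHS]big_mkcond ler_sum // => t _.
(* The conditioning sees only coordinate 0, which is not resampled. *)
have w_upd (x : T i) : w (upd t x) = w t.
  by rewrite /w int_pt_upd ifN_eqC.
under eq_bigr => x _ do rewrite w_upd mulrCA.
rewrite -big_distrr /= /w; case: eqP => _; last by rewrite mul0r mulr0.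
by rewrite mul1r [leRHS]mulrC ler_wpM2l ?prod_distr_ge0 // first_zero_upd_le.
Qed.

End ZeroProbability.

(** * Union bound over degrees and divisors *)

Lemma rmorph_meval n (R K : comNzRingType) (f : {rmorphism R -> K}) (v : 'I_n -> R)
    (p : {mpoly R[n]}) :
  f p.@[v] = mmap f (f \o v) p.
Proof.
rewrite mevalE rmorph_sum; apply: eq_bigr => m _; rewrite rmorphM rmorph_prod.
by congr (_ * _); apply: eq_bigr => i _; rewrite rmorphXn.
Qed.

(** Both signs are listed, whence the factor 2 in the final bound. *)
Definition int_divisors (n : int) : seq int :=
  [seq k%:Z | k <- divisors `|n|] ++ [seq - k%:Z | k <- divisors `|n|].

Lemma size_int_divisors n : size (int_divisors n) = (2 * tau n)%N.
Proof. by rewrite size_cat !size_map mul2n -addnn. Qed.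

Lemma mem_int_divisors b n : n != 0 -> (b \in int_divisors n) = (b %| n)%Z.
Proof.
move=> n0; have an : (0 < `|n|)%N by rewrite absz_gt0.
rewrite mem_cat; apply/orP/idP => [[]/mapP[k]|].
- by rewrite -dvdn_divisors // => kn ->; rewrite dvdzE.
- by rewrite -dvdn_divisors // => kn ->; rewrite dvdzE abszN.
- rewrite dvdzE; case: b => k bn; [left|right]; apply/mapP.
  + by exists k => //; rewrite -dvdn_divisors.
  + by exists k.+1; rewrite ?NegzE -?dvdn_divisors.
Qed.

Section Param.
Variables (R : realType) (L d m : nat) (F : 'I_d.-1 -> {mpoly R[m.+1]}).
Hypothesis d_gt0 : (0 < d)%N.
Hypothesis F_deg : forall j, (msize (F j) <= L.+1)%N.

(** [a0] is separate from [u ord0], so the constant coefficient and its divisor stay fixed along the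
    walk. *)
Definition Pdk_at j a0 b0 (u : 'I_m.+1 -> R) : R[i] :=
  Pdk j a0 b0 (map_mx (real_complex R) (evalF F u)).

Lemma Pdk_at_line j a0 b0 (u : 'I_m.+1 -> R) i :
  exists2 q : {poly R[i]}, (size q <= (2 ^ d * L).+1)%N &
    forall x : R, Pdk_at j a0 b0 (fun l => if l == i then x else u l) = q.[x%:C%C].
Proof.
(* Place [i] becomes the indeterminate and the others constants, so each [F e] has degree at most
   [L] along the line. *)
pose v l : {poly R[i]} := if l == i then 'X else ((u l)%:C%C)%:P.
pose c e := mmap (fun a => (real_complex R a)%:P) v (F e).
have hc e : (size (c e) <= L.+1)%N.
  rewrite -[L]muln1; apply: size_mmap_polyC => // l; rewrite /v.
  by case: ifP; rewrite ?size_polyX // (leq_trans (size_polyC_leq1 _)).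
have [q qN qE] := Pdk_line d_gt0 j a0 b0 hc; exists q => // x.
rewrite -qE /Pdk_at; congr Pdk; apply/rowP => e.
rewrite !mxE horner_mmap_polyC rmorph_meval; congr mmap; apply/funext => l /=.
by rewrite /v; case: ifP => _; rewrite ?hornerX ?hornerC.
Qed.

End Param.

Section UnionBound.
Variables (R : realType) (L d m : nat) (C : R) (F : 'I_d.-1 -> {mpoly R[m.+1]}).
Hypothesis d_gt0 : (0 < d)%N.
Hypothesis C_gt0 : 0 < C.
Hypothesis F_deg : forall j, (msize (F j) <= L.+1)%N.
Variables (T : 'I_m.+1 -> {fset int}) (D : forall i : 'I_m.+1, T i -> R).
Hypothesis D_distr : forall i, is_distr (@D i).
Hypothesis D_unif : forall i, CT_uniform C (2 ^ d * L) (@D i).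
Hypothesis F_nonzero : forall (j : nat) (a0 b0 : int),
  (0 < j < d)%N -> a0 != 0 -> (b0 %| a0)%Z ->
  ~ (forall t : 'I_m -> R, Pdk_at F j a0 b0 (cons_pt a0%:~R t) = 0).

Local Notation K :=
  (C * (2 ^ d * L)%:R * \sum_(i < m.+1 | (0 < i)%N) (#|` T i|)%:R^-1).

Definition root_count (t : {dffun forall i, T i}) : R :=
  \sum_(j < d | (0 < j)%N) \sum_(b <- int_divisors (val (t ord0)))
    (Pdk_at F j (val (t ord0)) b (int_pt R t) == 0)%:R.

Lemma expect_root_count_le :
  \sum_t prod_distr (@D) t * ((val (t ord0) != 0)%:R * root_count t)
  <= 2 * d%:R * K *
     \sum_t prod_distr (@D) t * ((tau (val (t ord0)))%:R * (val (t ord0) != 0)%:R).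
Proof.
have K0 : 0 <= K.
  by rewrite !mulr_ge0 ?(ltW C_gt0) // sumr_ge0 // => i _; rewrite invr_ge0.
(* Grouping by the value [z] of coordinate 0 fixes the list of divisors. *)
rewrite (partition_big (fun t : {dffun forall i, T i} => t ord0) xpredT) //=.
rewrite [X in _ <= _ * X](partition_big (fun t : {dffun forall i, T i} => t ord0) xpredT) //=.
rewrite big_distrr /= ler_sum // => z _.
pose S := \sum_(t : {dffun forall i, T i} | t ord0 == z) prod_distr (@D) t.
have S0 : 0 <= S by rewrite sumr_ge0 // => t _; apply: prod_distr_ge0.
have -> : \sum_(t : {dffun forall i, T i} | t ord0 == z)
    prod_distr (@D) t * ((tau (val (t ord0)))%:R * (val (t ord0) != 0)%:R)
    = S * ((tau (val z))%:R * (val z != 0)%:R).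
  by rewrite big_distrl; apply: eq_bigr => t /eqP ->.
have [z0|z0] := eqVneq (val z) 0.
  by rewrite !mulr0 big1 // => t /eqP ->; rewrite z0 eqxx mul0r mulr0.
rewrite mulr1.
have step (j : nat) b : (0 < j < d)%N -> b \in int_divisors (val z) ->
    \sum_(t : {dffun forall i, T i} | t ord0 == z)
      prod_distr (@D) t * (Pdk_at F j (val z) b (int_pt R t) == 0)%:R <= K * S.
  move=> jd; rewrite mem_int_divisors // => bz.
  (* The walk starts at a point where the product is nonzero, with coordinate 0 set to [z]. *)
  have /existsNP[ts /eqP tsP] := F_nonzero jd z0 bz.
  have tz (t : {dffun forall i, T i}) :
      (t ord0 == z) = (int_pt R t ord0 == cons_pt (val z)%:~R ts ord0).
    by rewrite /int_pt /cons_pt unlift_none eqr_int (inj_eq val_inj).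
  rewrite /S !(eq_bigl _ _ tz).
  exact: (prob_zero_le C_gt0 D_distr D_unif (fun u i _ => Pdk_at_line d_gt0 F_deg j _ _ u i)).
apply: le_trans (_ : \sum_(j < d | (0 < j)%N) \sum_(b <- int_divisors (val z)) K * S <= _).
  rewrite (eq_bigr (fun t : {dffun forall i, T i} =>
    \sum_(j < d | (0 < j)%N) \sum_(b <- int_divisors (val z))
       prod_distr (@D) t * (Pdk_at F j (val z) b (int_pt R t) == 0)%:R)); last first.
    move=> t /eqP tz; rewrite /root_count tz z0 mul1r big_distrr.
    by apply: eq_bigr => j _; rewrite big_distrr.
  rewrite exchange_big /= ler_sum // => j j0.
  rewrite exchange_big /= [leLHS]big_seq [leRHS]big_seq ler_sum // => b bz.
  by apply: step => //; rewrite j0 ltn_ord.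
have KS0 : 0 <= K * S by exact: mulr_ge0.
have -> : 2 * d%:R * K * (S * (tau (val z))%:R) = (K * S) *+ (2 * tau (val z) * d).
  by rewrite -[RHS]mulr_natr !natrM; ring.
move: (K * S) KS0 => KS KS0.
under eq_bigr do rewrite big_const_seq count_predT size_int_divisors iter_addr_0.
rewrite big_const iter_addr_0 -mulrnA; apply: ler_wpMn2l => //.
(* The positive degrees below [d] are counted as [d]. *)
rewrite leq_mul2l orbC -[X in (_ <= X)%N](card_ord d).
by rewrite max_card.
Qed.

End UnionBound.

(** * Transfer to the law of the coefficients *)

Theorem theorem2p3 (R : realType) (L : nat) (C : R) (m d : nat)
  (hL : (0 < L)%N) (hC : 0 < C) (hm : (1 <= m)%N) (hd : (1 < d)%N)
  (T : 'I_m.+1 -> {fset int}) (k : 'I_m.+1 -> nat)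
  (hk : forall i, #|` T i| = k i) (hk_gt0 : forall i, (0 < k i)%N)
  (D : forall i : 'I_m.+1, T i -> R)
  (hD : forall i, is_distr (D i))
  (hDunif : forall i, CT_uniform C (2 ^ d * L) (D i))
  (* D_a is the law of the lower coefficients (a_0, (a_1, ..., a_(d-1))) of f *)
  (Sa : {fset int * 'rV[int]_d.-1}) (Da : Sa -> R)
  (hDa : is_distr Da)
  (F : 'I_d.-1 -> {mpoly R[m.+1]})
  (hFdeg : forall j, (msize (F j) <= L.+1)%N)
  (h1 : forall w : R * 'rV[R]_d.-1,
     pushforward Da (fun a => real_coefs R (val a)) w =
     pushforward (prod_distr D) (fun t => param_coefs F (fun i => val (t i))) w)
  (h2 : forall (j : nat) (a0 b0 : int),
     (0 < j < d)%N -> a0 != 0 -> (b0 %| a0)%Z ->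
     ~ (forall t : 'I_m -> R,
          Pdk j a0 b0 (map_mx (real_complex R) (evalF F (cons_pt a0%:~R t))) = 0)) :
  1 - prob Da (fun a => (val a).1 = 0)
    - 2 * C * d%:R * 2 ^+ d * L%:R * tau_distr Da (fun a => (val a).1)
        * (\sum_(i < m.+1 | (0 < i)%N) (k i)%:R^-1)
  <= prob Da (fun a => irreducibleZ (monic_of (val a).1 (val a).2)).
Proof.
have d0 : (0 < d)%N by exact: ltnW.
have [Da0 Da1] := hDa.
(* Reducibility and the divisor count become functions of real points, so that the push-forward
   identity applies; [Num.floor] recovers the integer constant coefficient. *)
pose reducible (w : R * 'rV[R]_d.-1) := exists a : int * 'rV[int]_d.-1,
  [/\ real_coefs R a = w, a.1 != 0 & ~ irreducibleZ (monic_of a.1 a.2)].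
pose G w : R := `[< reducible w >]%:R.
pose tauG (w : R * 'rV[R]_d.-1) : R :=
  (tau (Num.floor w.1))%:R * (Num.floor w.1 != 0)%:R.
have tauE : tau_distr Da (fun a => (val a).1)
    = \sum_t prod_distr D t * ((tau (val (t ord0)))%:R * (val (t ord0) != 0)%:R).
  have := eq_pushforward_expect tauG h1; rewrite /tauG /=.
  under eq_bigr do rewrite intrKfloor.
  by under [RHS]eq_bigr do rewrite intrKfloor.
have G_le (t : {dffun forall i, T i}) : G (param_coefs F (fun i => val (t i)))
    <= (val (t ord0) != 0)%:R * root_count F t.
  have rc0 : 0 <= root_count F t by rewrite sumr_ge0 // => j _; rewrite sumr_ge0.
  rewrite /G; case: asboolP => [[[a0 a] [/= [ta Fa] a00 nirr]]|_]; last exact: mulr_ge0.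
  have {}ta : val (t ord0) = a0 by apply: (@intr_inj R).
  have [j [b [jd ba0 Pb]]] := reducible_Pdk_eq0 R hd nirr.
  rewrite /root_count ta (ta : fsval _ = _) a00 mul1r.
  have [j0 jltd] := andP jd.
  (* The pair [j], [b] found from the factorization contributes 1 to the count. *)
  rewrite (bigD1 (Ordinal jltd)) //= (big_rem b) /=; last by rewrite mem_int_divisors.
  rewrite (_ : _ == 0 = true) ?mulr1n; last first.
    apply/eqP; rewrite -[RHS]Pb /Pdk_at -Fa; congr Pdk.
    by apply/matrixP => x y; rewrite !mxE rmorph_int.
  rewrite -addrA lerDl addr_ge0 ?sumr_ge0 // => j' _; rewrite sumr_ge0 //.
have main : \sum_a Da a * G (real_coefs R (val a)) <=
   2 * C * d%:R * 2 ^+ d * L%:R * tau_distr Da (fun a => (val a).1)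
        * (\sum_(i < m.+1 | (0 < i)%N) (k i)%:R^-1).
  rewrite (eq_pushforward_expect G h1).
  apply: le_trans (_ : \sum_t prod_distr D t *
      ((val (t ord0) != 0)%:R * root_count F t) <= _).
    by apply: ler_sum => t _; rewrite ler_wpM2l ?prod_distr_ge0.
  apply: le_trans (expect_root_count_le d0 hC hFdeg hD hDunif h2) _.
  rewrite -tauE natrM natrX (eq_bigr (fun i => (k i)%:R^-1)) => [|i _]; last by rewrite hk.
  by rewrite le_eqVlt; apply/orP; left; apply/eqP; ring.
rewrite -addrA -opprD lerBlDr -[leLHS]Da1 /prob.
(* Every outcome is irreducible, has zero constant coefficient, or is counted by [G], so the three
   indicators sum to at least 1. *)
apply: le_trans (_ : \sum_a Da a * ((`[< irreducibleZ (monic_of (val a).1 (val a).2) >])%:R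
   + (`[< (val a).1 = 0 >]%:R + G (real_coefs R (val a)))) <= _); last first.
  under eq_bigr do rewrite mulrDr mulrDr.
  rewrite !big_split /= lerD //; last apply: lerD => //.
    by rewrite [leRHS]big_mkcond ler_sum // => a _; case: ifP; rewrite ?mulr1 ?mulr0.
  by rewrite [leRHS]big_mkcond ler_sum // => a _; case: ifP; rewrite ?mulr1 ?mulr0.
apply: ler_sum => a _; rewrite ler_peMr //.
have [irr|nirr] := asboolP (irreducibleZ _); first by rewrite lerDl addr_ge0.
have [a0|/eqP a0] := asboolP ((val a).1 = 0); first by rewrite add0r lerDl.
by rewrite !add0r /G asboolT //; exists (val a).
Qed.
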